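(* Let $\mathbb{K}=\mathbb{R}$ or $\mathbb{C}$, let $0<r<n$, and let $A=\begin{pmatrix} I_r & 0 \\ 0 & 0 \end{pmatrix}$, $B=\begin{pmatrix} 0 & 0 \\ 0 & I_{n-r} \end{pmatrix}$ in $M_n(\mathbb{K})$ (so $A$ and $B$ are idempotent with $AB=BA=0$, and $\operatorname{rank}(A)=\operatorname{nullity}(B)=r$). Then any solution $X\in M_n(\mathbb{K})$ of the system $XAX=BXB$, $XBX=AXA$, partitioned into blocks conformally with $A$ and $B$ (so that $C$ is $r\times(n-r)$ and $D$ is $(n-r)\times r$), has one of the following forms. (a) $X=\begin{pmatrix} 0 & C \\ D & 0 \end{pmatrix}$ with $CD=0$ and $DC=0$. (b) $X=\begin{pmatrix} 0 & C \\ D & Y_2 \end{pmatrix}$, where $Y_2=UJU^{-1}$ for some $U\in GL_{n-r}(\mathbb{K})$ and some $(n-r)\times(n-r)$ matrix $J$ of type $\mathcal{J}$, and for $Z=CU$, $W=U^{-1}D$ one has $ZJ=0$, $JW=0$, $ZW=0$, $WZ=J$. (c) $X=\begin{pmatrix} Y_1 & C \\ D & 0 \end{pmatrix}$, where $Y_1=VJV^{-1}$ for some $V\in GL_r(\mathbb{K})$ and some $r\times r$ matrix $J$ of type $\mathcal{J}$, and for $Z=V^{-1}C$, $W=DV$ one has $JZ=0$, $WJ=0$, $ZW=J$, $WZ=0$. (d) $X=\begin{pmatrix} Y_1 & C \\ D & Y_2 \end{pmatrix}$, where $Y_1=U_1JU_1^{-1}$ and $Y_2=U_2J'U_2^{-1}$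 for some $(U_1,U_2)\in GL_r(\mathbb{K})\times GL_{n-r}(\mathbb{K})$ and some matrices $J$ ($r\times r$) and $J'$ ($(n-r)\times(n-r)$) of type $\mathcal{J}$, and for $Z_1=U_1^{-1}C$, $Z_2=CU_2$, $W_1=DU_1$, $W_2=U_2^{-1}D$ one has $JZ_1=0$, $Z_2J'=0$, $W_1J=0$, $J'W_2=0$, $Z_1W_1=J$, $W_2Z_2=J'$.
   Context: Let $J_2=\begin{pmatrix} 0 & 1 \\ 0 & 0 \end{pmatrix}$. A square matrix is said to be of type $\mathcal{J}$ if it is a block diagonal matrix of the form $\operatorname{diag}(J_2,J_2,\dots,J_2,0,0,\dots,0)$, with some number of $J_2$ blocks followed by zeros on the diagonal. *)

(* Defs.v *)
From HB Require Import structures.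
From mathcomp Require Import all_boot all_order all_algebra.
From mathcomp Require Import complex reals.
Set Implicit Arguments.
Unset Strict Implicit.
Unset Printing Implicit Defensive.
Import GRing.Theory.
Local Open Scope ring_scope.

Definition J2 (K : fieldType) : 'M[K]_2 := delta_mx 0 1.

(* The number of J2 blocks and the number of trailing zeros may each be 0;
   note that 2 + m reduces to m.+2, so every size of J is covered. *)
Inductive typeJ (K : fieldType) : forall m : nat, 'M[K]_m -> Prop :=
| typeJ_zero (m : nat) : typeJ (0 : 'M[K]_m)
| typeJ_block (m : nat) (J : 'M[K]_m) :
    typeJ J -> typeJ (block_mx (J2 K) 0 0 J : 'M[K]_(2 + m)).

(* Main.v *)
Require Import Defs.
From HB Require Import structures.
From mathcomp Require Import all_boot all_order all_algebra.
From mathcomp Require Import complex reals.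
Set Implicit Arguments.
Unset Strict Implicit.
Unset Printing Implicit Defensive.
Import GRing.Theory.
Local Open Scope ring_scope.

(* Comparing blocks, the system says exactly that Y1 = C D and Y2 = D C square
   to zero and that Y1 C, D Y1, C Y2 and Y2 D vanish. Hence X always has form (d),
   which contains (a), (b) and (c), once square-zero matrices are known to be
   similar to matrices of type J. For the latter, if v N w != 0, then the
   N-stable subspace {x | x w = x N w = 0} of row vectors is a complement of
   the plane spanned by v and v N, on which N acts as J2. *)

(** The row count of the basis is a given [k] instead of the term [\rank M], so that the basis can
    later be stacked under two rows in a matrix of size [2 + k]. *)
Lemma row_free_same_space (K : fieldType) (m n k : nat) (M : 'M[K]_(m, n)) :
  \rank M = k -> exists2 E : 'M[K]_(k, n), row_free E & (E :=: M)%MS.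
Proof. by move=> <-; exists (row_base M); [exact: row_base_free | exact: eq_row_base]. Qed.

Lemma square_zero_similar_typeJ (K : fieldType) (m : nat) (N : 'M[K]_m) :
  N *m N = 0 ->
  exists U J : 'M[K]_m, [/\ U \in unitmx, typeJ J & N = U *m J *m invmx U].
Proof.
elim/ltn_ind: m => m IH in N *; move=> NN.
have [->|N0] := eqVneq N 0.
  exists 1%:M, 0; split; [exact: unitmx1 | exact: typeJ_zero |].
  by rewrite mulmx0 mul0mx.
have /matrix0Pn[i [j Nij]] := N0.
pose v : 'rV[K]_m := delta_mx 0 i; pose w : 'cV[K]_m := delta_mx j 0.
have vNw : v *m N *m w = (N i j)%:M.
  by rewrite -rowE -colE; apply/matrixP => a b; rewrite !ord1 !mxE eqxx mulr1n.
pose A : 'M[K]_(1 + 1, m) := col_mx v (v *m N).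
(* The left kernel of [B] is the complement sought, and the row space of [A] is the plane. *)
pose B : 'M[K]_(m, 1 + 1) := row_mx (N *m w) w.
(* Since [N *m N = 0], the product is upper triangular with [N i j] twice on the diagonal. *)
have AB_unit : A *m B \in unitmx.
  rewrite /A /B mul_col_row !mulmxA vNw -(mulmxA v N N) NN mulmx0 mul0mx.
  rewrite unitmxE det_ublock !det_scalar1.
  by rewrite unitfE mulf_neq0.
have m_ge2 : (1 + 1 <= m)%N.
  rewrite -(mxrank_unit AB_unit).
  exact: leq_trans (mxrankM_maxl _ _) (rank_leq_col _).
(* Writing the size as [k.+2] makes it convertible to [2 + k], as the block matrices below
   require. *)
case: m => [|[|k]] // in IH N NN N0 i j Nij v w vNw A B AB_unit m_ge2 *.
have rkB : \rank B = (1 + 1)%N.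
  apply/eqP; rewrite eqn_leq rank_leq_col /=.
  by rewrite -{1}(mxrank_unit AB_unit) mxrankM_maxr.
have [|E E_free EB] := @row_free_same_space K _ _ k (kermx B).
  by rewrite mxrank_ker rkB subn2.
have EB0 : E *m B = 0 by apply/sub_kermxP; rewrite EB.
(* If [x] is killed by [N *m w] and [w], so is [x *m N], because [N *m N = 0]. Thus [M] is the
   matrix of [N] restricted to the complement in the basis [E]. *)
have [M EN] : exists M, E *m N = M *m E.
  apply/submxP; rewrite EB; apply/sub_kermxP.
  rewrite /B mul_mx_row !mulmxA -(mulmxA E N N) NN mulmx0 mul0mx.
  move: EB0; rewrite /B mul_mx_row mulmxA -[0]row_mx0 => /eq_row_mx[-> _].
  by rewrite row_mx0.
have MM : M *m M = 0.
  apply: (row_free_inj E_free); rewrite -mulmxA -EN mulmxA -EN -mulmxA NN.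
  by rewrite mulmx0 mul0mx.
have [U [J [U_unit J_typ MUJ]]] := IH k (leqnSn _) M MM.
pose P : 'M[K]_(2 + k) := col_mx A E.
have P_unit : P \in unitmx.
  (* In a linear relation among the rows of [P], multiplying by [B] kills the [E] part;
     invertibility of [A *m B] then kills the [A] part. *)
  rewrite -row_free_unit -kermx_eq0; apply/rowV0P => x /sub_kermxP.
  rewrite -[x]hsubmxK mul_row_col => xP.
  have x1 : lsubmx x = 0.
    have : (lsubmx x *m A + rsubmx x *m E) *m B = 0 by rewrite xP mul0mx.
    rewrite mulmxDl -!mulmxA EB0 mulmx0 addr0 => /(congr1 (mulmx^~ (invmx (A *m B)))).
    by rewrite mulmxK // mul0mx.
  have x2 : rsubmx x = 0.
    apply: (row_free_inj E_free).
    by move: xP; rewrite x1 !mul0mx add0r.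
  by rewrite x1 x2 row_mx0.
have AN : A *m N = J2 K *m A.
  rewrite /A mul_col_mx -mulmxA NN mulmx0.
  have -> : J2 K = block_mx 0 1%:M 0 0 :> 'M[K]_(1 + 1).
    apply/matrixP => a b; rewrite !mxE.
    case: splitP => a'; rewrite !ord1 => a_eq; rewrite !mxE;
      case: splitP => b'; rewrite !ord1 => b_eq; rewrite !mxE -!val_eqE /= a_eq b_eq //.
  by rewrite [RHS](mul_block_col (0 : 'M_1) 1%:M 0 0) !mul0mx mul1mx !add0r.
pose Q : 'M[K]_(2 + k) := block_mx 1%:M 0 0 U.
have Q_unit : Q \in unitmx.
  by rewrite unitmxE det_ublock det1 mul1r -unitmxE.
pose L : 'M[K]_(2 + k) := block_mx (J2 K) 0 0 J.
(* In the basis [P], [N] becomes the block diagonal of [J2 K] and [M]; [Q] leaves the first block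
   alone and brings [M] to [J]. *)
have PN : P *m N = Q *m L *m invmx Q *m P.
  have QL : block_mx (J2 K) 0 0 M *m Q = Q *m L.
    rewrite /Q /L !mulmx_block !(mulmx0, mul0mx, mulmx1, mul1mx, addr0, add0r).
    by rewrite MUJ mulmxKV.
  rewrite -QL mulmxK // /P mul_block_col mul_col_mx AN EN !mul0mx.
  by rewrite addr0 add0r.
exists (invmx P *m Q), L; split; [|exact: typeJ_block|].
  by rewrite unitmx_mul unitmx_inv P_unit.
have -> : invmx (invmx P *m Q) = invmx Q *m P.
  apply: (row_free_inj (A := invmx P *m Q)).
    by rewrite row_free_unit unitmx_mul unitmx_inv P_unit.
  rewrite mulVmx ?unitmx_mul ?unitmx_inv ?P_unit //.
  by rewrite mulmxA mulmxK // mulVmx.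
by rewrite -[LHS](mulKmx P_unit) PN !mulmxA.
Qed.

Theorem theorem5p2 (R : realType) (K : fieldType)
    (hK : K = (R : fieldType) \/ K = (R[i] : fieldType))
    (r n : nat) (hr : (0 < r < n)%N) (A B X : 'M[K]_(r + (n - r)))
    (hA : A = block_mx 1%:M 0 0 0) (hB : B = block_mx 0 0 0 1%:M)
    (hXA : X *m A *m X = B *m X *m B) (hXB : X *m B *m X = A *m X *m A) :
  exists (C : 'M[K]_(r, n - r)) (D : 'M[K]_(n - r, r)),
  [\/ [/\ X = block_mx 0 C D 0, C *m D = 0 & D *m C = 0],
      exists Y2 U J : 'M[K]_(n - r),
        [/\ X = block_mx 0 C D Y2, U \in unitmx, typeJ J,
            Y2 = U *m J *m invmx U
          & let Z := C *m U in let W := invmx U *m D in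
            [/\ Z *m J = 0, J *m W = 0, Z *m W = 0 & W *m Z = J]],
      exists Y1 V J : 'M[K]_r,
        [/\ X = block_mx Y1 C D 0, V \in unitmx, typeJ J,
            Y1 = V *m J *m invmx V
          & let Z := invmx V *m C in let W := D *m V in
            [/\ J *m Z = 0, W *m J = 0, Z *m W = J & W *m Z = 0]]
    | exists (Y1 U1 J : 'M[K]_r) (Y2 U2 J' : 'M[K]_(n - r)),
        [/\ X = block_mx Y1 C D Y2,
            U1 \in unitmx /\ U2 \in unitmx,
            typeJ J /\ typeJ J',
            Y1 = U1 *m J *m invmx U1 /\ Y2 = U2 *m J' *m invmx U2
          & let Z1 := invmx U1 *m C in let Z2 := C *m U2 in
            let W1 := D *m U1 in let W2 := invmx U2 *m D in
            [/\ J *m Z1 = 0 /\ Z2 *m J' = 0,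
                W1 *m J = 0 /\ J' *m W2 = 0,
                Z1 *m W1 = J & W2 *m Z2 = J']]].
Proof.
have [Y1 [C [D [Y2 eX]]]] : exists Y1 C D Y2, X = block_mx Y1 C D Y2.
  by exists (ulsubmx X), (ursubmx X), (dlsubmx X), (drsubmx X); rewrite submxK.
move: hXA hXB; rewrite {}hA {}hB eX !mulmx_block.
rewrite !(mulmx0, mul0mx, mulmx1, mul1mx, addr0, add0r).
move=> /eq_block_mx[Y1Y1 Y1C DY1 DC] /eq_block_mx[CD CY2 Y2D Y2Y2].
have [U1 [J1 [U1_unit J1_typ Y1E]]] := square_zero_similar_typeJ Y1Y1.
have [U2 [J2 [U2_unit J2_typ Y2E]]] := square_zero_similar_typeJ Y2Y2.
(* Solving for the type J factors turns each identity of (d) into a conjugate of one of the block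
   equations. *)
have J1E : J1 = invmx U1 *m Y1 *m U1 by rewrite Y1E !mulmxA mulVmx // mul1mx mulmxKV.
have J2E : J2 = invmx U2 *m Y2 *m U2 by rewrite Y2E !mulmxA mulVmx // mul1mx mulmxKV.
exists C, D; apply: Or44; exists Y1, U1, J1, Y2, U2, J2; split=> //=.
split; first split.
- by rewrite J1E mulmxA mulmxK // -mulmxA Y1C mulmx0.
- by rewrite J2E !mulmxA mulmxK // CY2 mul0mx.
- by split; [rewrite J1E !mulmxA mulmxK // DY1 mul0mx
            |rewrite J2E mulmxA mulmxK // -mulmxA Y2D mulmx0].
- by rewrite J1E -CD !mulmxA.
- by rewrite J2E -DC !mulmxA.
Qed.
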